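(* The following assertion is false: ''If $G$ is a cyclically 5-edge-connected cubic graph and $\mathcal D$ is a set of pairwise disjoint cycles of $G$, then $\mathcal D$ is a subset of a cycle double cover of $G$, unless $G$ is the Petersen graph.'' Indeed, there are 12 pairwise non-isomorphic counterexamples $G$ on 34 vertices.
   Context: A cycle is a connected 2-regular graph (here a subgraph of $G$). A cycle double cover (CDC) of a graph $G$ is a multiset of cycles of $G$ such that each edge of $G$ lies in exactly two of them. A graph is cyclically $k$-edge-connected if the deletion of fewer than $k$ edges does not create two components both of which contain at least one cycle. A counterexample is a cyclically 5-edge-connected cubic graph $G$, not the Petersen graph, having a set of pairwise disjoint cycles that is not a subset of any CDC of $G$. *)

(* Defs.v *)
From HB Require Import structures.
From mathcomp Require Import all_boot.

Set Implicit Arguments.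
Unset Strict Implicit.
Unset Printing Implicit Defensive.

Record sgraph := SGraph {
  svertex :> finType;
  sedge : rel svertex;
  sedge_sym : symmetric sedge;
  sedge_irr : irreflexive sedge
}.

(* An edge is the two-element set of its endpoints. *)
Definition edges (G : sgraph) : {set {set G}} :=
  [set [set x; y] | x in G, y in G & sedge x y].

Definition cubic (G : sgraph) : Prop :=
  forall x : G, #|[set y | sedge x y]| = 3.

Definition isomorphic (G H : sgraph) : Prop :=
  exists2 f : G -> H, bijective f & forall x y, sedge (f x) (f y) = sedge x y.

(* A subgraph of G is encoded as the pair of its vertex set and its edge set,
   subject to [is_subgraph]. *)
Definition subgraph (G : sgraph) : finType := ({set G} * {set {set G}})%type.

Definition is_subgraph (G : sgraph) (C : subgraph G) : bool :=
  (C.2 \subset edges G) && (cover C.2 \subset C.1).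

Definition two_regular (G : sgraph) (C : subgraph G) : bool :=
  [forall x in C.1, #|[set e in C.2 | x \in e]| == 2].

(* The empty graph is not connected. *)
Definition connected_subgraph (G : sgraph) (C : subgraph G) : bool :=
  (C.1 != set0) &&
  [forall x in C.1, forall y in C.1,
     connect [rel u v | [set u; v] \in C.2] x y].

Definition is_cycle (G : sgraph) (C : subgraph G) : bool :=
  [&& is_subgraph C, two_regular C & connected_subgraph C].

Definition del_rel (G : sgraph) (F : {set {set G}}) : rel G :=
  fun x y => sedge x y && ([set x; y] \notin F).

Lemma del_rel_sym (G : sgraph) (F : {set {set G}}) : symmetric (del_rel F).
Proof. by move=> x y; rewrite /del_rel sedge_sym setUC. Qed.

Lemma del_rel_irr (G : sgraph) (F : {set {set G}}) : irreflexive (del_rel F).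
Proof. by move=> x; rewrite /del_rel sedge_irr. Qed.

Definition del_edges (G : sgraph) (F : {set {set G}}) : sgraph :=
  SGraph (del_rel_sym F) (del_rel_irr F).

Definition components (G : sgraph) : {set {set G}} :=
  [set [set y | connect (@sedge G) x y] | x : G].

Definition contains_cycle (G : sgraph) (A : {set G}) : Prop :=
  exists C : subgraph G, is_cycle C /\ C.1 \subset A.

(* With F empty this says that G itself does not have two components that
   contain cycles; in particular, for k > 0, a cubic graph satisfying it is
   connected. *)
Definition cyclically_edge_connected (k : nat) (G : sgraph) : Prop :=
  forall F : {set {set G}}, F \subset edges G -> #|F| < k ->
  ~ exists A B : {set del_edges F},
      [/\ A \in components (del_edges F), B \in components (del_edges F),
          A != B, contains_cycle A & contains_cycle B].

Definition disjoint_cycles (G : sgraph) (D : {set subgraph G}) : Prop :=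
  (forall C, C \in D -> is_cycle C) /\
  (forall C1 C2, C1 \in D -> C2 \in D -> C1 != C2 -> [disjoint C1.1 & C2.1]).

(* The sequence stands for the multiset of its entries. *)
Definition cycle_double_cover (G : sgraph) (S : seq (subgraph G)) : Prop :=
  all (@is_cycle G) S /\
  (forall e, e \in edges G -> count (fun C : subgraph G => e \in C.2) S = 2).

(* The Petersen graph as the Kneser graph K(5,2): its vertices are the
   two-element subsets of a five-element set, adjacent when disjoint. *)
Definition petersen_vertex : finType := {A : {set 'I_5} | #|A| == 2}.

Definition petersen_rel : rel petersen_vertex :=
  fun A B => [disjoint val A & val B].

Lemma petersen_sym : symmetric petersen_rel.
Proof. by move=> A B; rewrite /petersen_rel /= disjoint_sym. Qed.

Lemma petersen_irr : irreflexive petersen_rel.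
Proof.
move=> [A cA]; rewrite /petersen_rel /=; apply/negbTE; rewrite -setI_eq0 setIid -card_gt0.
by rewrite (eqP cA).
Qed.

Definition petersen : sgraph := SGraph petersen_sym petersen_irr.

Definition counterexample (G : sgraph) : Prop :=
  [/\ cyclically_edge_connected 5 G, cubic G, ~ isomorphic G petersen &
      exists D : {set subgraph G}, disjoint_cycles D /\
        ~ exists S : seq (subgraph G),
            cycle_double_cover S /\ {subset D <= S}].

(* Main.v *)
Require Import Defs.
From HB Require Import structures.
From mathcomp Require Import all_boot perm.
From mathcomp Require Import zify.

Set Implicit Arguments.
Unset Strict Implicit.
Unset Printing Implicit Defensive.

(** Each counterexample is a permutation graph: two disjoint 17-cycles, the rims,
    joined by a perfect matching of spokes, which is given by a permutation p of
    17 points.  The set of cycles that extends to no cycle double cover consists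
    of the two rims.

    Suppose that a cycle double cover contains both rims.  The other members of
    the cover use every rim edge once and every spoke twice.  A cycle that passes
    through a vertex uses two of its three edges, so the two rim edges at a vertex
    lie on different members, and these are the two members that contain the
    spoke.  Labelling each rim edge by the member that contains it, the two rim
    edges at one end of a spoke therefore carry two different labels, and the two
    rim edges at the other end carry the same two labels ([cover_labelling]).  For
    each spoke there are two ways to match the labels of its ends, and a
    backtracking search ([refutes]) shows that every combination forces the same
    label on two consecutive rim edges ([unlabellableP]).

    For the cyclic connectivity, deleting fewer than five edges leaves two
    components with cycles only if some vertex set A has at most four boundary
    edges while both A and its complement have at least three vertices.  The
    boundary of A contains an even number of edges of each rim.  Going through the
    few possibilities, A must consist of an interval of one rim and an interval of
    the other that p maps onto each other, so it suffices that p maps no interval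
    of length between 2 and 15 onto an interval
    ([pgraph_cyclically_5_edge_connected]).

    The twelve graphs are told apart by the trace of the ninth power of the
    adjacency matrix, in the form [walk_pairing] with exponents 4 and 5. *)

(** * Cyclic connectivity from edge boundaries *)

Section CyclicCuts.

Variable G : sgraph.
Implicit Types (A : {set G}) (C : subgraph G).

Definition boundary A : {set {set G}} :=
  [set e in edges G | [exists x in A, exists y in ~: A, e == [set x; y]]].

Lemma edgesP (e : {set G}) :
  reflect (exists x y : G, e = [set x; y] /\ sedge x y) (e \in edges G).
Proof.
apply: (iffP imset2P) => [[x y _ Hy ->]|[x [y [-> Hxy]]]].
  by exists x, y; split=> //; move: Hy; rewrite !inE.
by exists x y; rewrite ?inE.
Qed.

Lemma mem_edges (x y : G) : sedge x y -> [set x; y] \in edges G.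
Proof. by move=> xy; apply/edgesP; exists x, y. Qed.

Lemma edge_at (e : {set G}) (x : G) :
  e \in edges G -> x \in e -> exists2 y, sedge x y & e = [set x; y].
Proof.
case/edgesP=> [a [b [-> ab]]]; rewrite !inE => /orP[]/eqP->.
  by exists b.
by exists a; [rewrite sedge_sym | rewrite setUC].
Qed.

Lemma sedge_neq (x y : G) : sedge x y -> x != y.
Proof. by apply: contraTneq => ->; rewrite sedge_irr. Qed.

Lemma cycle_card_ge3 C : is_cycle C -> 2 < #|C.1|.
Proof.
case/and3P=> /andP[sub cov] /forallP reg /andP[/set0Pn[x xC] _].
have /cards2P[e1 [e2 [ne12 E]]] : #|[set e in C.2 | x \in e]| == 2.
  by have /implyP := reg x; apply.
have : e1 \in [set e in C.2 | x \in e] by rewrite E !inE eqxx.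
have : e2 \in [set e in C.2 | x \in e] by rewrite E !inE eqxx orbT.
rewrite !inE => /andP[e2C xe2] /andP[e1C xe1].
have [y1 xy1 Ee1] := edge_at (subsetP sub _ e1C) xe1.
have [y2 xy2 Ee2] := edge_at (subsetP sub _ e2C) xe2.
have y12 : y1 != y2 by apply: contraNneq ne12 => y12; rewrite Ee1 Ee2 y12.
have yC y e : e \in C.2 -> y \in e -> y \in C.1.
  by move=> eC ye; apply: (subsetP cov); apply/bigcupP; exists e.
have <- : #|x |: [set y1; y2]| = 3.
  by rewrite cardsU1 cards2 y12 !inE negb_or !sedge_neq.
apply: subset_leq_card; apply/subsetP=> z; rewrite !inE => /or3P[]/eqP-> //.
  by apply: yC e1C _; rewrite Ee1 !inE eqxx orbT.
by apply: yC e2C _; rewrite Ee2 !inE eqxx orbT.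
Qed.

End CyclicCuts.

(** Two different components of G - F that contain cycles are disjoint, so the
    first of them and its complement both have at least three vertices, and every
    edge of its boundary lies in F. *)
Lemma cyclically_edge_connected_boundary (G : sgraph) k :
  (forall A : {set G}, 2 < #|A| -> 2 < #|~: A| -> k <= #|boundary A|) ->
  cyclically_edge_connected k G.
Proof.
move=> bnd F _ ltFk [_ [_ [/imsetP[a _ ->] /imsetP[b _ ->]]]].
set A := [set y | _]; set B := [set y | _] => neAB cycA cycB.
have card_of (D : {set del_edges F}) : contains_cycle D -> 2 < #|D|.
  case=> C [cC sub]; apply: leq_trans (subset_leq_card sub).
  exact: cycle_card_ge3.
have sym : connect_sym (@sedge (del_edges F)).
  by apply: sym_connect_sym => x y; rewrite sedge_sym.
have subB : B \subset ~: A.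
  apply/subsetP=> y; rewrite !inE => b_y; apply: contra neAB => a_y.
  apply/eqP/setP=> z; rewrite !inE; apply: (same_connect sym).
  by apply: connect_trans a_y _; rewrite sym.
have := bnd A (card_of _ cycA) (leq_trans (card_of _ cycB) (subset_leq_card subB)).
apply/negP; rewrite -ltnNge; apply: leq_ltn_trans ltFk.
apply: subset_leq_card; apply/subsetP=> e; rewrite inE => /andP[eG].
case/existsP=> x /andP[xA] /existsP[y] /andP[yA /eqP eE].
apply: contraTT yA => eF; rewrite !inE negbK.
move: xA; rewrite inE => /connect_trans; apply; apply: connect1.
rewrite /= /del_rel -eE eF andbT.
case/edgesP: eG => x' [y' [E xy']]; move: eE; rewrite E => /setP eE.
have := eE x; have := eE y; rewrite !inE !eqxx orbT /=.
have := eE x'; have := eE y'; rewrite !inE !eqxx orbT /=.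
case/esym/orP=> /eqP yy; case/esym/orP=> /eqP xx; subst x' y' => //.
- by rewrite sedge_irr in xy'.
- by rewrite sedge_sym.
- by rewrite sedge_irr in xy'.
Qed.

(** * Permutation graphs *)

Section PermutationGraph.

Variables (n : nat) (p : {perm 'I_n.+3}).

(** The Boolean selects the rim; the ordinal is the position on it. *)
Definition pvertex := (bool * 'I_n.+3)%type.
Implicit Types (v w : pvertex) (b : bool) (i j : 'I_n.+3).

Definition rim_next v : pvertex := (v.1, ordS v.2).
Definition rim_prev v : pvertex := (v.1, ord_pred v.2).
Definition mate v : pvertex := (~~ v.1, if v.1 then (p^-1)%g v.2 else p v.2).
Definition neighbours v := [:: rim_next v; rim_prev v; mate v].

Lemma rim_nextK : cancel rim_next rim_prev.
Proof. by case=> b i; rewrite /rim_next /rim_prev /= ordSK. Qed.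

Lemma rim_prevK : cancel rim_prev rim_next.
Proof. by case=> b i; rewrite /rim_next /rim_prev /= ord_predK. Qed.

Lemma mateK : involutive mate.
Proof. by case=> [[] i]; rewrite /mate /= ?permK ?permKV. Qed.

Lemma ordS_neq i : ordS i != i.
Proof.
rewrite -val_eqE /=; have := ltn_ord i; rewrite leq_eqVlt => /orP[/eqP ei|lti].
  by rewrite ei modnn; case: (nat_of_ord i) ei.
by rewrite modn_small // neq_ltn leqnn orbT.
Qed.

Lemma ordSS_neq i : ordS (ordS i) != i.
Proof.
rewrite -val_eqE /= -addn1 modnDml addn1.
have := ltn_ord i; rewrite leq_eqVlt => /orP[/eqP ei|].
  by rewrite ei -addn1 modnDl modn_small; lia.
rewrite leq_eqVlt => /orP[/eqP ei|lti]; first by rewrite ei modnn; lia.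
by rewrite modn_small // neq_ltn; apply/orP; right; apply: leqnSn.
Qed.

Lemma reach_ordS i j : exists2 k, k < n.+3 & iter k (@ordS n.+3) i = j.
Proof.
exists ((j + (n.+3 - i)) %% n.+3); first exact: ltn_pmod.
have val_it k : val (iter k (@ordS n.+3) i) = (i + k) %% n.+3.
  elim: k => [|k IH]; first by rewrite addn0 modn_small.
  by rewrite /= IH -addn1 modnDml addn1 addnS.
apply: val_inj; rewrite val_it modnDmr addnCA subnKC ?modnDr ?modn_small //.
exact: ltnW.
Qed.

Lemma uniq_neighbours v : uniq (neighbours v).
Proof.
case: v => b i; rewrite /= !inE !xpair_eqE !eqxx /= andbT.
have -> : (ordS i == ord_pred i) = false.
  by rewrite -(can2_eq (@ordSK _) (@ord_predK _)) (negbTE (ordSS_neq i)).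
by case: b.
Qed.

Lemma neighbours_sym : symmetric (fun v w => w \in neighbours v).
Proof.
move=> v w; rewrite !inE ![w == _]eq_sym (can2_eq rim_nextK rim_prevK).
by rewrite (can2_eq rim_prevK rim_nextK) (can2_eq mateK mateK) orbCA.
Qed.

Lemma neighbours_irr : irreflexive (fun v w => w \in neighbours v).
Proof.
case=> b i; rewrite !inE !xpair_eqE eqxx /= -(can2_eq (@ordSK _) (@ord_predK _)).
by rewrite eq_sym (negbTE (ordS_neq i)); case: b.
Qed.

Definition pgraph : sgraph := SGraph neighbours_sym neighbours_irr.

Lemma pgraph_cubic : cubic pgraph.
Proof.
move=> v; transitivity #|neighbours v|; last exact/card_uniqP/uniq_neighbours.
by apply: eq_card => w; rewrite inE.
Qed.

Lemma card_pgraph : #|pgraph| = n.+3.*2.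
Proof. by rewrite card_prod card_bool card_ord mul2n. Qed.

Definition rim_edge v : {set pgraph} := [set v; rim_next v].
Definition spoke v : {set pgraph} := [set v; mate v].

Lemma rim_edge_in v : rim_edge v \in edges pgraph.
Proof. by apply: mem_edges; rewrite /= !inE eqxx. Qed.

Lemma spoke_in v : spoke v \in edges pgraph.
Proof. by apply: mem_edges; rewrite /= !inE eqxx !orbT. Qed.

Lemma set2_inj (T : finType) (x y z : T) : [set x; y] = [set x; z] -> y = z.
Proof.
move=> /setP E; have := E y; have := E z; rewrite !inE !eqxx !orbT.
by case/orP=> /eqP // -> /esym/orP[]/eqP.
Qed.

Lemma rim_edge_prev v : rim_edge (rim_prev v) = [set v; rim_prev v].
Proof. by rewrite /rim_edge rim_prevK setUC. Qed.

Definition star v : seq {set pgraph} := [:: rim_edge v; rim_edge (rim_prev v); spoke v].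

Lemma starE v : star v = [seq [set v; w] | w <- neighbours v].
Proof. by rewrite /star /= rim_edge_prev. Qed.

Lemma uniq_star v : uniq (star v).
Proof. by rewrite starE map_inj_uniq ?uniq_neighbours //; apply: set2_inj. Qed.

Lemma edge_star (e : {set pgraph}) v : e \in edges pgraph -> (v \in e) = (e \in star v).
Proof.
move=> eG; apply/idP/idP => [/(edge_at eG)[w vw ->]|].
  by rewrite starE; apply/mapP; exists w.
by rewrite starE => /mapP[w _ ->]; rewrite !inE eqxx.
Qed.

(** The edges at a vertex form its star, so degrees in a subgraph are counts over
    a list of three edges. *)
Lemma card_at_vertex (C : subgraph pgraph) v : is_subgraph C ->
  #|[set e in C.2 | v \in e]| = count (mem C.2) (star v).
Proof.
case/andP=> sub _; rewrite -size_filter -(card_uniqP (filter_uniq _ (uniq_star v))).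
apply: eq_card => e; rewrite inE mem_filter /=; apply: andb_id2l => eC.
exact/edge_star/(subsetP sub).
Qed.

Definition rim b : subgraph pgraph :=
  ([set v | v.1 == b], [set rim_edge v | v in [set v : pvertex | v.1 == b]]).

Lemma rim_edgeE v w : (rim_edge v == rim_edge w) = (v == w).
Proof.
apply/eqP/eqP=> [/setP E|-> //]; have := E (rim_next v); have := E v.
rewrite !inE !eqxx orbT /= => /esym/orP[/eqP // | /eqP vE].
case/esym/orP=> /eqP => [|/(can_inj rim_nextK) //]; rewrite vE => /(congr1 snd)/= /eqP.
by rewrite (negbTE (ordSS_neq _)).
Qed.

Lemma mem_rim_edge v b : (rim_edge v \in (rim b).2) = (v.1 == b).
Proof.
apply/imsetP/idP => [[w]|vb]; last by exists v; rewrite ?inE.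
by rewrite inE => wb /eqP; rewrite rim_edgeE => /eqP->.
Qed.

Lemma spoke_notin_rim v b : spoke v \notin (rim b).2.
Proof.
apply/imsetP => -[w _ E]; have same x : x \in rim_edge w -> x.1 = w.1.
  by rewrite !inE => /orP[]/eqP->.
have : (mate v).1 = v.1 by rewrite !same // -E !inE eqxx ?orbT.
by case: (v) => [[]].
Qed.

Lemma rim_subgraph b : is_subgraph (rim b).
Proof.
apply/andP; split.
  by apply/subsetP=> _ /imsetP[v _ ->]; apply: rim_edge_in.
apply/bigcupsP => _ /imsetP[v vb ->]; apply/subsetP=> w.
by move: vb; rewrite !inE => /eqP <- /orP[]/eqP->.
Qed.

Lemma rim_connected b : connected_subgraph (rim b).
Proof.
apply/andP; split; first by apply/set0Pn; exists (b, ord0); rewrite inE.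
set e := [rel u v | _].
have sym : connect_sym e by apply: sym_connect_sym => u v; rewrite /= setUC.
have step i k : connect e (b, i) (b, iter k (@ordS n.+3) i).
  elim: k => //= k IH; apply: connect_trans IH (connect1 _).
  by rewrite /= (mem_rim_edge (b, _)).
have reach v : v.1 == b -> connect e (b, ord0) v.
  by case: v => c i /= /eqP->; have [k _ <-] := reach_ordS ord0 i.
apply/forallP=> u; apply/implyP; rewrite inE => ub.
apply/forallP=> v; apply/implyP; rewrite inE => vb.
by apply: connect_trans (reach _ vb); rewrite sym reach.
Qed.

Lemma rim_cycle b : is_cycle (rim b).
Proof.
rewrite /is_cycle rim_subgraph rim_connected andbT.
apply/forallP=> v; apply/implyP; rewrite inE => /eqP vb.
rewrite card_at_vertex ?rim_subgraph //= !mem_rim_edge /= vb eqxx.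
by rewrite (negbTE (spoke_notin_rim v b)).
Qed.

Lemma rims_disjoint : [disjoint (rim false).1 & (rim true).1].
Proof. by rewrite disjoint_subset; apply/subsetP=> v; rewrite !inE => /eqP->. Qed.

(** * Labellings of the rim edges *)

(** The rim edge from v to its successor carries the label of v, so the two rim
    edges at v carry the labels of v and of its predecessor. *)
Definition transition_labelling (T : eqType) (lab : pvertex -> T) : Prop :=
  forall v, lab v != lab (rim_prev v) /\
    ((lab (mate v) = lab v /\ lab (rim_prev (mate v)) = lab (rim_prev v)) \/
     (lab (mate v) = lab (rim_prev v) /\ lab (rim_prev (mate v)) = lab v)).

Lemma card_positions (T : eqType) (a : pred T) (s : seq T) :
  #|[set k : 'I_(size s) | a (tnth (in_tuple s) k)]| = count a s.
Proof.
rewrite -sum1_count (big_tnth _ _ s) -sum1_card.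
by apply: eq_bigl => k; rewrite inE.
Qed.

(** A cycle uses none or exactly two of the three edges at a vertex. *)
Lemma cycle_at_vertex (C : subgraph pgraph) v : is_cycle C ->
  (spoke v \in C.2) = (rim_edge v \in C.2) (+) (rim_edge (rim_prev v) \in C.2).
Proof.
case/and3P=> sub /forallP/(_ v) reg _.
suff : count (mem C.2) (star v) \in [:: 0; 2].
  by rewrite /= addn0; do 3!case: (_ \in C.2).
have [vC|vC] := boolP (v \in C.1).
  by move: reg; rewrite vC card_at_vertex // => /eqP ->.
rewrite -card_at_vertex // (_ : [set _ in _ | _] = set0) ?cards0 //.
apply/setP=> e; rewrite !inE; apply: contraNF vC => /andP[eC ve].
by case/andP: sub => _ /subsetP; apply; apply/bigcupP; exists e.
Qed.

(** The label of a rim edge is the set of positions of the cycles that contain it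
    in the cover with both rims removed.  This set is a singleton, and the
    positions of the cycles that contain a spoke form a set of size two, which is
    the union of the labels at either end of the spoke. *)
Lemma cover_labelling (S : seq (subgraph pgraph)) :
  cycle_double_cover S -> rim false \in S -> rim true \in S ->
  exists (T : eqType) (lab : pvertex -> T), transition_labelling lab.
Proof.
move=> [cycS covS] S0 S1.
have neq_rims : rim true != rim false.
  apply/eqP=> /(congr1 (fun C : subgraph pgraph => (true, ord0) \in C.1)).
  by rewrite !inE.
have S1' : rim true \in rem (rim false) S by apply: rem_mem.
pose S' := rem (rim true) (rem (rim false) S).
have permS : perm_eq S [:: rim false, rim true & S'].
  by apply: perm_trans (perm_to_rem S0) _; rewrite perm_cons perm_to_rem.
have cycS' C : C \in S' -> is_cycle C.
  by move=> CS; apply: (allP cycS); rewrite (perm_mem permS) !inE CS !orbT.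
pose at_ (e : {set pgraph}) : {set 'I_(size S')} :=
  [set k | e \in (tnth (in_tuple S') k).2].
have card_at e : e \in edges pgraph ->
    #|at_ e| + (e \in (rim false).2) + (e \in (rim true).2) = 2.
  move=> eG; rewrite (card_positions (fun C : subgraph pgraph => e \in C.2)) -(covS e eG).
  by rewrite (seq.permP permS) /= [RHS]addnA [RHS]addnC addnA.
have at_rim v : #|at_ (rim_edge v)| == 1.
  by have := card_at _ (rim_edge_in v); rewrite !mem_rim_edge; case: v.1 => /=; lia.
have at_spoke v : #|at_ (spoke v)| = 2.
  by have := card_at _ (spoke_in v); rewrite !(negbTE (spoke_notin_rim _ _)) !addn0.
have split_at v k : (k \in at_ (spoke v)) =
    (k \in at_ (rim_edge v)) (+) (k \in at_ (rim_edge (rim_prev v))).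
  by rewrite !inE cycle_at_vertex // cycS' // mem_tnth.
pose lab v := at_ (rim_edge v).
have lab1 v : exists k, lab v = [set k].
  exact/cards1P/at_rim.
exists {set 'I_(size S')}, lab => v.
have lab_neq w : lab w != lab (rim_prev w).
  apply/eqP=> E; have := at_spoke w; rewrite (_ : at_ _ = set0) ?cards0 //.
  by apply/setP=> k; rewrite split_at -[at_ (rim_edge w)]/(lab w) E addbb inE.
split=> //.
have lab_spoke w : at_ (spoke w) = lab w :|: lab (rim_prev w).
  apply/setP=> k; rewrite split_at in_setU.
  have := lab_neq w; have [a Ea] := lab1 w; have [b Eb] := lab1 (rim_prev w).
  rewrite -[at_ (rim_edge w)]/(lab w) -[at_ (rim_edge (rim_prev w))]/(lab (rim_prev w)) Ea Eb !inE.
  by case: (k =P a) => [->|]; case: (_ =P b) => // ->; rewrite eqxx.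
have E : lab v :|: lab (rim_prev v) = lab (mate v) :|: lab (rim_prev (mate v)).
  by rewrite -!lab_spoke /spoke mateK setUC.
have := lab_neq v; have := lab_neq (mate v); move: E.
have [a ->] := lab1 v; have [b ->] := lab1 (rim_prev v).
have [c ->] := lab1 (mate v); have [d ->] := lab1 (rim_prev (mate v)).
move=> /setP E ncd nab.
have := E a; have := E b; have := E c; have := E d; rewrite !inE !eqxx ?orbT /=.
move=> Ed Ec Eb Ea.
case/orP: Ed => /eqP Ed; case/orP: Ec => /eqP Ec; subst; auto.
- by rewrite eqxx in ncd.
- by rewrite eqxx in ncd.
Qed.

(** * Small edge cuts of a permutation graph *)

(** Apart from the full set, a set with k exits is the union of k intervals of the
    cycle, no two of which are adjacent. *)
Definition exits (X : {set 'I_n.+3}) := [set i in X | ordS i \notin X].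

(** A single exit means an interval.  The images of intervals of length one, and of
    intervals that miss one point, always are intervals. *)
Definition no_common_interval : Prop := forall X : {set 'I_n.+3},
  #|exits X| = 1 -> #|exits (p @: X)| = 1 -> (#|X| <= 1) || (#|~: X| <= 1).

(** Going around the cycle, a set is left as often as it is entered. *)
Lemma card_changes (X : {set 'I_n.+3}) :
  #|[set i | (i \in X) != (ordS i \in X)]| = (#|exits X|).*2.
Proof.
pose Y := (@ordS n.+3) @^-1: X.
have cardY : #|Y| = #|X| by apply: on_card_preimset; exists (@ord_pred _) => i _; rewrite ?ordSK ?ord_predK.
have -> : exits X = X :\: Y by apply/setP=> i; rewrite !inE andbC.
have -> : [set i | (i \in X) != (ordS i \in X)] = (X :\: Y) :|: (Y :\: X).
  by apply/setP=> i; rewrite !inE; do 2!case: (_ \in X).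
rewrite cardsU (_ : _ :&: _ = set0) ?cards0 ?subn0.
  by rewrite -addnn !cardsD cardY setIC.
by apply/setP=> i; rewrite !inE; do 2!case: (_ \in X).
Qed.

Lemma exits_eq0 (X : {set 'I_n.+3}) : #|exits X| = 0 -> X = set0 \/ X = setT.
Proof.
move/eqP; rewrite cards_eq0 => /eqP E.
have closed i : i \in X -> ordS i \in X.
  by move=> iX; have := in_set0 i; rewrite -E inE iX => /negbFE.
have [->|[i iX]] := set_0Vmem X; [by left | right].
apply/eqP; rewrite eqEsubset subsetT; apply/subsetP=> j _.
have it k : iter k (@ordS _) i \in X by elim: k => //= k; apply: closed.
by have [k _ <-] := reach_ordS i j.
Qed.

Definition fibre (A : {set pvertex}) b := [set i | (b, i) \in A].

Lemma card_fibre (A : {set pvertex}) : #|A| = #|fibre A false| + #|fibre A true|.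
Proof.
rewrite -!sum1_card addnC -(big_bool _ (fun b => \sum_(i in fibre A b) 1)).
rewrite pair_big_dep; apply: eq_bigl => -[b i].
by rewrite inE.
Qed.

Lemma fibreC (A : {set pvertex}) b : fibre (~: A) b = ~: fibre A b.
Proof. by apply/setP=> i; rewrite !inE. Qed.

Lemma spoke_inj : {in [pred v : pvertex | ~~ v.1] &, injective spoke}.
Proof.
move=> v w; rewrite !inE => vb wb /setP/(_ v); rewrite !inE eqxx /=.
by case/esym/orP=> /eqP // E; move: vb; rewrite E /= wb.
Qed.

(** The rim edges in the boundary are counted by [card_changes] on each rim, and
    the third summand counts the spokes in the boundary. *)
Lemma card_boundary_ge (A : {set pgraph}) :
  (#|exits (fibre A false)|).*2 + (#|exits (fibre A true)|).*2
    + #|[set i | (i \in fibre A false) != (p i \in fibre A true)]| <= #|boundary A|.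
Proof.
pose R : {set pvertex} := [set v | (v \in A) != (rim_next v \in A)].
pose M : {set pvertex} := [set v | ~~ v.1 && ((v \in A) != (mate v \in A))].
have cardR : #|R| = (#|exits (fibre A false)|).*2 + (#|exits (fibre A true)|).*2.
  rewrite card_fibre -!card_changes.
  by congr (_ + _); apply: eq_card => i; rewrite !inE.
have cardM : #|M| = #|[set i | (i \in fibre A false) != (p i \in fibre A true)]|.
  rewrite card_fibre [X in _ + X](_ : _ = 0) ?addn0.
    by apply: eq_card => i; rewrite !inE.
  by apply/eqP; rewrite cards_eq0; apply/eqP/setP=> i; rewrite !inE.
have cut (x y : pgraph) : sedge x y -> (x \in A) != (y \in A) -> [set x; y] \in boundary A.
  move=> xy neA; rewrite inE mem_edges //=.
  have [xA|xA] := boolP (x \in A); rewrite ?xA ?(negbTE xA) /= in neA.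
    apply/existsP; exists x; rewrite xA; apply/existsP; exists y.
    by rewrite inE eqxx andbT; case: (y \in A) neA.
  apply/existsP; exists y; rewrite (_ : y \in A); last by case: (y \in A) neA.
  by apply/existsP; exists x; rewrite inE xA setUC eqxx.
rewrite -cardR -cardM.
have <- : #|@rim_edge @: R| = #|R|.
  by apply: card_imset => v w /eqP; rewrite rim_edgeE => /eqP.
have <- : #|spoke @: M| = #|M|.
  apply: card_in_imset => v w; rewrite !inE => /andP[vb _] /andP[wb _].
  by apply: spoke_inj.
have disj : (@rim_edge @: R) :&: (spoke @: M) = set0.
  apply/setP=> e; rewrite !inE; apply/negP=> /andP[/imsetP[v _ ->] /imsetP[w _ E]].
  by have := spoke_notin_rim w v.1; rewrite -E mem_rim_edge eqxx.
rewrite -[leqLHS]subn0 -(cards0 {set pgraph}) -disj -cardsU subset_leq_card //.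
rewrite subUset; apply/andP; split; apply/subsetP=> _ /imsetP[v vP ->]; apply: cut.
- by rewrite /= !inE eqxx.
- by move: vP; rewrite inE.
- by rewrite /= !inE eqxx !orbT.
- by move: vP; rewrite inE => /andP[].
Qed.

(** X and Y are the traces on the two rims of a vertex set with at most four
    boundary edges.  If both have an exit, each has exactly one and no spoke is
    cut, so both are intervals and p maps X onto Y.  If Y has no exit, it is empty
    or everything, and the spokes from X (or from its complement) are all cut;
    there are at most two of them if X has an exit, and likewise with X and Y
    exchanged.  If neither has an exit, the cut contains all of the at least five
    spokes or none of them. *)
Lemma small_cut_trivial (X Y : {set 'I_n.+3}) : 1 < n -> no_common_interval ->
  (#|exits X|).*2 + (#|exits Y|).*2 + #|[set i | (i \in X) != (p i \in Y)]| <= 4 ->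
  (#|X| + #|Y| <= 2) || (#|~: X| + #|~: Y| <= 2).
Proof.
move=> n_gt1 simple; set M := [set i | _] => le4.
have pY : #|p @^-1: Y| = #|Y|.
  by apply: on_card_preimset; exists (p^-1)%g => i _; rewrite ?permK ?permKV.
have pYC : #|p @^-1: ~: Y| = #|~: Y|.
  by apply: on_card_preimset; exists (p^-1)%g => i _; rewrite ?permK ?permKV.
have M0 : X = set0 -> #|M| = #|Y|.
  by move=> X0; rewrite -pY; apply: eq_card => i; rewrite !inE X0 inE; case: (_ \in Y).
have MT : X = setT -> #|M| = #|~: Y|.
  by move=> XT; rewrite -pYC; apply: eq_card => i; rewrite !inE XT inE; case: (_ \in Y).
have M0' : Y = set0 -> #|M| = #|X|.
  by move=> Y0; apply: eq_card => i; rewrite !inE Y0 inE; case: (_ \in X).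
have MT' : Y = setT -> #|M| = #|~: X|.
  by move=> YT; apply: eq_card => i; rewrite !inE YT inE; case: (_ \in X).
have cX := cardsC X; have cY := cardsC Y; rewrite card_ord in cX cY.
have ex (Z : {set 'I_n.+3}) : 0 < #|exits Z| \/ (Z = set0 /\ #|Z| = 0) \/ (Z = setT /\ #|~: Z| = 0).
  case: (posnP #|exits Z|) => [/exits_eq0[->|->]|]; last by left.
    by right; left; rewrite cards0.
  by right; right; rewrite setCT cards0.
have [uX|[[X0 cX0]|[XT cXT]]] := ex X; have [uY|[[Y0 cY0]|[YT cYT]]] := ex Y.
- have uX1 : #|exits X| = 1 by lia.
  have uY1 : #|exits Y| = 1 by lia.
  have YE : Y = p @: X.
    have M_empty : #|M| == 0 by lia.
    apply/setP=> j; rewrite -[j](permKV p) (mem_imset _ _ perm_inj).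
    move: M_empty; rewrite cards_eq0 => /eqP/setP/(_ ((p^-1)%g j)).
    by rewrite !inE => /negbFE/eqP.
  have cYE : #|Y| = #|X| by rewrite YE card_imset //; apply: perm_inj.
  by rewrite YE in uY1; have := simple X uX1 uY1; lia.
- by have := M0' Y0; lia.
- by have := MT' YT; lia.
- by have := M0 X0; lia.
- by lia.
- by have := M0 X0; lia.
- by have := MT XT; lia.
- by have := MT XT; lia.
- by lia.
Qed.

Lemma pgraph_cyclically_5_edge_connected :
  1 < n -> no_common_interval -> cyclically_edge_connected 5 pgraph.
Proof.
move=> n_gt1 simple; apply: cyclically_edge_connected_boundary => A.
rewrite !card_fibre !fibreC => gt2 gt2C; rewrite ltnNge; apply/negP=> le4.
have := small_cut_trivial n_gt1 simple (leq_trans (card_boundary_ge A) le4).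
by rewrite [_ <= 2]leqNgt gt2 [_ <= 2]leqNgt gt2C.
Qed.

(** Intervals are listed backwards, starting at their unique exit. *)
Definition back_arc i (l : nat) : seq 'I_n.+3 := traject (@ord_pred n.+3) i l.

Lemma back_arc_full i : back_arc i n.+3 =i predT /\ uniq (back_arc i n.+3).
Proof.
have full : back_arc i n.+3 =i predT.
  move=> j; apply/trajectP; have [k ltk E] := reach_ordS j i.
  exists k => //; rewrite -E; elim: k {ltk E} => // k IH.
  by rewrite iterSr iterS ordSK.
split=> //; apply/card_uniqP; rewrite size_traject (eq_card full).
by rewrite card_ord.
Qed.

(** Walking backwards from the exit, the set can be left only once before the walk
    returns to the exit: re-entering it would pass a second exit. *)
Lemma exits_eq1 (X : {set 'I_n.+3}) : #|exits X| = 1 -> exists i, X = [set j in back_arc i #|X|].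
Proof.
move/eqP/cards1P=> [t E]; exists t.
have [full uniq_full] := back_arc_full t; set s := back_arc t n.+3 in full uniq_full.
have size_s : size s = n.+3 by apply: size_traject.
have nth_s k : k < n.+3 -> nth t s k = iter k (@ord_pred _) t.
  by move=> ltk; rewrite nth_traject.
have back k : k.+1 < n.+3 -> nth t s k \notin X -> nth t s k.+1 \notin X.
  move=> ltk; rewrite !nth_s //= => [kX|]; last exact: ltnW.
  apply/negP=> kX'; have : iter k.+1 (@ord_pred _) t \in exits X.
    by rewrite inE /= kX' ord_predK.
  rewrite E inE => /eqP Et; have := nth_s _ ltk; rewrite Et => /eqP.
  by rewrite -[X in _ == X]/(nth t s 0) nth_uniq ?size_s.
pose L := find [pred j | j \notin X] s.
have after k : L <= k -> k < n.+3 -> nth t s k \notin X.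
  move=> Lk; rewrite -(subnKC Lk); elim: (k - L) => [|m IH] ltN.
    by rewrite addn0 in ltN *; apply: (nth_find t (a := [pred j | j \notin X])); rewrite has_find size_s.
  rewrite addnS; apply: back; first by rewrite -addnS.
  by apply: IH; lia.
have XE : X = [set j in take L s].
  apply/setP=> j; have js : j \in s by rewrite full.
  have ltj : index j s < n.+3 by move: js; rewrite -index_mem size_s.
  rewrite inE in_take //; have [ltL|geL] := ltnP.
    by have := before_find t ltL; rewrite nth_index //= => /negbFE.
  by apply/negbTE; rewrite -(nth_index t js) after.
have leL : L <= n.+3 by have := find_size [pred j | j \notin X] s; rewrite size_s.
have cardX : #|X| = L.
  rewrite XE (_ : #|_| = #|take L s|); last by apply: eq_card => j; rewrite inE.
  have /card_uniqP-> : uniq (take L s) by apply: take_uniq.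
  by rewrite size_takel ?size_s.
by rewrite cardX {1}XE take_traject.
Qed.

Lemma card_exits_seq (s : seq 'I_n.+3) : uniq s ->
  #|exits [set j in s]| = count (fun j => ordS j \notin s) s.
Proof.
move=> us; rewrite -size_filter -(card_uniqP (filter_uniq _ us)).
by apply: eq_card => j; rewrite !inE mem_filter andbC.
Qed.

Lemma no_common_interval_arc :
  (forall i l, 1 < l -> l < n.+2 ->
     count (fun j => ordS j \notin map p (back_arc i l)) (map p (back_arc i l)) != 1) ->
  no_common_interval.
Proof.
move=> H X uX upX; rewrite -[_ || _]negbK; apply/negP; rewrite negb_or -!ltnNge => /andP[gt1 gt1C].
have [i E] := exits_eq1 uX; have cX := cardsC X; rewrite card_ord in cX.
have ltX : #|X| < n.+2 by lia.
have /eqP := H i _ gt1 ltX; apply; rewrite -upX -card_exits_seq.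
  congr #|exits _|; apply/setP=> j; rewrite inE.
  apply/idP/imsetP=> [/mapP[k ks ->]|[k]]; first by exists k; rewrite // E inE.
  by rewrite {1}E inE => ks ->; apply: map_f.
rewrite (map_inj_uniq perm_inj) /back_arc.
have leX : #|X| <= n.+3 by lia.
rewrite -(take_traject _ _ leX) take_uniq //.
by case: (back_arc_full i).
Qed.

End PermutationGraph.

(** * A walk-counting invariant *)

Fixpoint walks (G : sgraph) (k : nat) (x y : G) : nat :=
  if k is k'.+1 then \sum_(z | sedge x z) walks k' z y else x == y.

(** This is the trace of the (k + l)-th power of the adjacency matrix, that is, the
    number of closed walks of length k + l.  Pairing two shorter walks keeps the
    numbers that are computed small. *)
Definition walk_pairing (G : sgraph) (k l : nat) : nat :=
  \sum_(y : G) \sum_(x : G) walks k x y * walks l x y.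

Lemma isomorphic_walk_pairing (G H : sgraph) k l :
  isomorphic G H -> walk_pairing G k l = walk_pairing H k l.
Proof.
case=> f bij_f f_edge; have walks_f m x y : walks m (f x) (f y) = walks m x y.
  elim: m x => [|m IH] x /=; first by rewrite (inj_eq (bij_inj bij_f)).
  rewrite (reindex f) /=; last exact: onW_bij.
  by apply: eq_big => [z|z _]; rewrite ?f_edge ?IH.
rewrite /walk_pairing [RHS](reindex f) /=; last exact: onW_bij.
apply: eq_bigr => y _; rewrite [RHS](reindex f) /=; last exact: onW_bij.
by apply: eq_bigr => x _; rewrite !walks_f.
Qed.

(** * Computing with permutations given as lists *)

Section Codes.

Variable n : nat.
Implicit Type c : seq nat.

Definition valid_code c := perm_eq c (iota 0 n.+3).

(** The default value 1 is taken only for lists that do not code a permutation. *)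
Definition perm_of_code c : {perm 'I_n.+3} :=
  insubd (1%g : {perm 'I_n.+3}) [ffun i : 'I_n.+3 => inord (nth 0 c i)].

Definition succ_mod i := if i == n.+2 then 0 else i.+1.
Definition pred_mod i := if i is j.+1 then j else n.+2.

Lemma val_ordS (i : 'I_n.+3) : val (ordS i) = succ_mod i.
Proof.
rewrite /= /succ_mod; case: eqP => [->|/eqP ni]; first by rewrite modnn.
by rewrite modn_small // ltnS ltn_neqAle ni -ltnS /=.
Qed.

Lemma val_ord_pred (i : 'I_n.+3) : val (ord_pred i) = pred_mod i.
Proof.
rewrite /= /pred_mod; case: i => [[|i] lti] /=; first by rewrite modn_small.
by rewrite modnDr modn_small // ltnW.
Qed.

Variable c : seq nat.
Hypothesis c_valid : valid_code c.
Let p := perm_of_code c.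

Let size_c : size c = n.+3.
Proof. by rewrite (perm_size c_valid) size_iota. Qed.

Let uniq_c : uniq c.
Proof. by rewrite (perm_uniq c_valid) iota_uniq. Qed.

Lemma perm_of_codeE i : val (p i) = nth 0 c i.
Proof.
have lt_c (k : 'I_n.+3) : nth 0 c k < n.+3.
  by have := mem_nth 0 (_ : k < size c); rewrite size_c (perm_mem c_valid) mem_iota; apply.
rewrite -pvalE insubdK; first by rewrite ffunE; apply: inordK.
apply/injectiveP=> j k; rewrite !ffunE => /(congr1 val); rewrite [LHS]inordK // [RHS]inordK // => /eqP.
by rewrite nth_uniq ?size_c // => /eqP/val_inj.
Qed.

Lemma perm_of_codeVE i : val ((p^-1)%g i) = index (val i) c.
Proof. by rewrite -[i in RHS](permKV p) perm_of_codeE index_uniq ?size_c. Qed.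

(** The number of exits of the image under the permutation of the interval of
    length l that ends at i. *)
Definition arc_image_ends i l :=
  let s := [seq nth 0 c j | j <- traject pred_mod i l] in
  count (fun j => succ_mod j \notin s) s.

Definition interval_free : bool :=
  all (fun i => all (fun l => arc_image_ends i l != 1) (iota 2 n)) (iota 0 n.+3).

Lemma interval_freeP : interval_free -> no_common_interval p.
Proof.
move=> /allP free; apply: no_common_interval_arc => i l l1 ln.
have iN : val i \in iota 0 n.+3 by rewrite mem_iota ltn_ord.
have lN : l \in iota 2 n by rewrite mem_iota l1 addnC addn2.
have arcE : [seq nth 0 c j | j <- traject pred_mod i l] = map val (map p (back_arc i l)).
  rewrite -map_comp (eq_map (g := nth 0 c \o val)); last by move=> j /=; rewrite perm_of_codeE.
  rewrite map_comp; congr map.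
  by elim: l (i) {l1 ln lN} => //= l IH j; rewrite -val_ord_pred IH.
have := allP (free _ iN) _ lN; rewrite /arc_image_ends arcE count_map.
congr (_ != 1); apply: eq_count => j /=.
by rewrite -val_ordS mem_map //; apply: val_inj.
Qed.

(** * Refuting labellings by backtracking *)

(** A function from the vertices to numbers, as a pair of lists of values: on the
    rim [false] and on the rim [true]. *)
Definition vertex_table := (seq nat * seq nat)%type.
Implicit Types st u : vertex_table.

Definition entry st (b : bool) i := nth 0 (if b then st.2 else st.1) i.

(** Tables serve here as partitions of the rim edges: edges with equal entries are
    known to carry equal labels.  The classes of edge i of the first rim and of
    edge j of the second are united. *)
Definition merge_classes st i j : vertex_table :=
  let x := entry st false i in let y := entry st true j in
  let f z := if z == y then x else z in (map f st.1, map f st.2).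

Definition clash st :=
  has (fun i => entry st false i == entry st false (pred_mod i)) (iota 0 n.+3).

(** For each spoke the labels at its ends are matched either in order or crosswise;
    both choices must lead to a clash.  Under call by value the Boolean connectives
    would evaluate both arguments, and hence explore pruned branches; the
    conditionals avoid this. *)
Fixpoint refutes (todo : seq nat) st : bool :=
  if clash st then true else
  if todo is i :: todo' then
    let j := nth 0 c i in let i' := pred_mod i in let j' := pred_mod j in
    if refutes todo' (merge_classes (merge_classes st i j) i' j')
    then refutes todo' (merge_classes (merge_classes st i j') i' j)
    else false
  else false.

Section Soundness.

Variables (T : eqType) (lab : pvertex n -> T).
Hypothesis labP : transition_labelling p lab.

(** Every identification made by the table holds for the given labelling. *)
Definition forced st : Prop :=
  [/\ size st.1 = n.+3, size st.2 = n.+3 & forall v w : pvertex n,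
    entry st v.1 v.2 = entry st w.1 w.2 -> lab v = lab w].

Lemma entry_merge st i j (v : pvertex n) : forced st ->
  entry (merge_classes st i j) v.1 v.2 =
  if entry st v.1 v.2 == entry st true j then entry st false i
  else entry st v.1 v.2.
Proof.
case=> s1 s2 _; case: v => b k.
by rewrite /entry; case: b => /=; rewrite (nth_map 0) ?s1 ?s2.
Qed.

Lemma forced_merge st (i j : 'I_n.+3) :
  forced st -> lab (false, i) = lab (true, j) -> forced (merge_classes st i j).
Proof.
move=> fst_ lab_ij; have [s1 s2 st_lab] := fst_; split; rewrite ?size_map //.
move=> v w; rewrite !entry_merge //.
case: eqP => [/(st_lab v (true, j)) ->|_]; case: eqP => [/(st_lab w (true, j)) ->|_] //.
- by rewrite -lab_ij; apply: (st_lab (false, i)).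
- by rewrite -lab_ij => /(st_lab _ (false, i)).
- exact: st_lab.
Qed.

Lemma forced_no_clash st : forced st -> clash st = false.
Proof.
case=> _ _ st_lab; apply/negP=> /hasP[i]; rewrite mem_iota add0n /= => lti /eqP E.
pose k : 'I_n.+3 := Ordinal lti.
have lab_eq : lab (false, k) = lab (rim_prev (false, k)).
  by apply: st_lab; rewrite -[nat_of_ord (rim_prev _).2]/(val (ord_pred k)) val_ord_pred.
by have [] := labP (false, k); rewrite lab_eq eqxx.
Qed.

(** At each spoke the labelling itself selects a branch in which all
    identifications remain true, so that branch never ends in a clash. *)
Lemma refutes_sound todo st :
  {subset todo <= iota 0 n.+3} -> forced st -> refutes todo st = false.
Proof.
elim: todo st => [|i todo IH] st sub fst_ /=; rewrite forced_no_clash //.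
have lti : i < n.+3 by have := sub i (mem_head _ _); rewrite mem_iota.
have sub' : {subset todo <= iota 0 n.+3} by move=> k k_in; apply: sub; rewrite inE k_in orbT.
pose k : 'I_n.+3 := Ordinal lti; pose v : pvertex n := (false, k).
pose l := (mate p v).2.
have mE : nth 0 c i = l by rewrite /l /= perm_of_codeE.
rewrite mE -[i]/(nat_of_ord k) -(val_ord_pred k) -(val_ord_pred l).
have [_ [[eq1 eq2]|[eq1 eq2]]] := labP v.
  rewrite IH //; apply: (forced_merge (i := ord_pred k) (j := ord_pred l)) (esym eq2).
  exact: (forced_merge (i := k) (j := l)) (esym eq1).
case: ifP => // _; apply: IH => //.
apply: (forced_merge (i := ord_pred k) (j := l)) (esym eq1).
exact: (forced_merge (i := k) (j := ord_pred l)) (esym eq2).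
Qed.

End Soundness.

(** The entries of the initial table are pairwise distinct. *)
Definition unlabellable := refutes (iota 0 n.+3) (iota 0 n.+3, iota n.+3 n.+3).

Lemma unlabellableP (T : eqType) (lab : pvertex n -> T) :
  unlabellable -> ~ transition_labelling p lab.
Proof.
move=> ref labP; suff : ~~ unlabellable by rewrite ref.
rewrite /unlabellable (refutes_sound labP) //; split; rewrite ?size_iota //.
have classE (v : pvertex n) : entry (iota 0 n.+3, iota n.+3 n.+3) v.1 v.2 = v.1 * n.+3 + v.2.
  case: v => [[] i]; rewrite /entry; first by rewrite [LHS]nth_iota // mul1n.
  by rewrite [LHS]nth_iota // mul0n.
move=> [b i] [d j]; rewrite !classE /= => E; congr lab.
have lti := ltn_ord i; have ltj := ltn_ord j.
by case: b d E => [[]|[]] /= E; [congr pair; apply: val_inj => /= | | | congr pair; apply: val_inj => /=]; lia.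
Qed.

(** * Computing walk counts *)

(** Multiplication of a vector, indexed by the vertices, by the adjacency matrix. *)
Definition adjacency_step u : vertex_table :=
  ([seq entry u false (succ_mod i) + entry u false (pred_mod i)
        + entry u true (nth 0 c i) | i <- iota 0 n.+3],
   [seq entry u true (succ_mod i) + entry u true (pred_mod i)
        + entry u false (index i c) | i <- iota 0 n.+3]).

Definition unit_table (d : bool) (j : nat) : vertex_table :=
  ([seq nat_of_bool (~~ d && (i == j)) | i <- iota 0 n.+3],
   [seq nat_of_bool (d && (i == j)) | i <- iota 0 n.+3]).

Lemma nth_map_iota (F : nat -> nat) (i : 'I_n.+3) :
  nth 0 [seq F k | k <- iota 0 n.+3] i = F i.
Proof. by rewrite (nth_map 0) ?size_iota // nth_iota. Qed.

Lemma walks_table k (v w : pgraph p) :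
  walks k v w = entry (iter k adjacency_step (unit_table w.1 w.2)) v.1 v.2.
Proof.
elim: k v => [|k IH] v.
  case: v w => [b i] [d j]; rewrite /entry /= xpair_eqE.
  by case: b; rewrite [RHS]nth_map_iota; case: d.
rewrite /= (eq_bigl (mem (neighbours p v))) // -big_uniq ?uniq_neighbours //=.
rewrite !big_cons big_nil addn0 !IH addnA.
case: v => [[] i]; rewrite [in RHS]/entry [RHS]nth_map_iota.
  by rewrite -perm_of_codeVE -val_ordS -val_ord_pred.
by rewrite -perm_of_codeE -val_ordS -val_ord_pred.
Qed.

Definition table_sum (F : bool -> nat -> nat) : nat :=
  sumn [seq F true i | i <- iota 0 n.+3] + sumn [seq F false i | i <- iota 0 n.+3].

Lemma table_sumE F : table_sum F = \sum_(v : pvertex n) F v.1 v.2.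
Proof.
rewrite -(pair_bigA _ (fun b (i : 'I_n.+3) => F b i)) big_bool.
by congr (_ + _); rewrite sumnE big_map -[iota 0 n.+3]/(index_iota 0 n.+3) big_mkord.
Qed.

Definition walk_pairing_code k l : nat :=
  table_sum (fun d j =>
    let u := iter k adjacency_step (unit_table d j) in
    let w := iter l adjacency_step (unit_table d j) in
    table_sum (fun b i => entry u b i * entry w b i)).

Lemma walk_pairing_codeE k l : walk_pairing (pgraph p) k l = walk_pairing_code k l.
Proof.
rewrite /walk_pairing_code table_sumE; apply: eq_bigr => w _.
by rewrite table_sumE; apply: eq_bigr => v _; rewrite !walks_table.
Qed.

End Codes.

(** * The twelve graphs *)

(** The i-th entry of a code is the position, on the second rim, of the other end
    of the spoke at position i of the first rim. *)
Definition codes : seq (seq nat) := [::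
  [:: 12; 15; 13; 8; 3; 1; 4; 10; 16; 9; 11; 2; 14; 6; 0; 7; 5];
  [:: 14; 5; 7; 0; 6; 12; 15; 13; 8; 3; 1; 4; 10; 16; 9; 11; 2];
  [:: 1; 12; 2; 0; 8; 14; 5; 11; 4; 6; 16; 13; 15; 3; 9; 7; 10];
  [:: 11; 9; 16; 10; 2; 14; 6; 0; 7; 5; 12; 15; 13; 8; 3; 1; 4];
  [:: 6; 4; 11; 5; 16; 13; 15; 3; 9; 7; 10; 1; 12; 2; 0; 8; 14];
  [:: 4; 6; 16; 5; 14; 11; 13; 7; 1; 3; 0; 9; 15; 8; 10; 2; 12];
  [:: 14; 6; 8; 1; 7; 12; 15; 13; 3; 5; 2; 10; 16; 9; 11; 4; 0];
  [:: 14; 7; 1; 8; 6; 12; 15; 13; 3; 5; 2; 10; 16; 9; 11; 4; 0];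
  [:: 1; 4; 2; 13; 11; 14; 5; 7; 0; 6; 12; 16; 3; 9; 15; 8; 10];
  [:: 6; 0; 7; 5; 12; 16; 3; 10; 8; 15; 9; 1; 4; 2; 13; 11; 14];
  [:: 1; 12; 2; 0; 6; 9; 7; 15; 13; 16; 4; 10; 3; 5; 14; 11; 8];
  [:: 5; 3; 10; 4; 14; 11; 8; 1; 12; 2; 0; 6; 9; 7; 15; 13; 16]].

Definition code_graph c : sgraph := pgraph (perm_of_code 14 c).

Lemma codes_valid : all (valid_code 14) codes.
Proof. by vm_compute. Qed.

Lemma codes_interval_free : all (interval_free 14) codes.
Proof. by vm_compute. Qed.

Lemma codes_unlabellable : all (unlabellable 14) codes.
Proof. by vm_compute. Qed.

Lemma codes_pairing_uniq : uniq [seq walk_pairing_code 14 c 4 5 | c <- codes].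
Proof. by vm_compute. Qed.

Lemma card_petersen : #|petersen| = 10.
Proof.
transitivity #|[set A : {set 'I_5} | #|A| == 2]|; last by rewrite card_draws card_ord.
by rewrite card_sig; apply: eq_card => A; rewrite inE.
Qed.

(** The rims are the disjoint cycles that no cycle double cover contains; a graph
    on 34 vertices cannot be the Petersen graph. *)
Lemma code_graph_counterexample c : c \in codes -> counterexample (code_graph c).
Proof.
move=> c_in; have c_valid := allP codes_valid c c_in.
split.
- apply: pgraph_cyclically_5_edge_connected => //.
  exact: interval_freeP (allP codes_interval_free c c_in).
- exact: pgraph_cubic.
- case=> f /bij_eq_card; rewrite card_petersen.
  by rewrite card_pgraph.
- exists [set rim _ false; rim _ true]; split.
    split=> [C|C1 C2]; rewrite !inE; first by case/orP=> /eqP->; apply: rim_cycle.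
    case/orP=> /eqP-> /orP[]/eqP->; rewrite ?eqxx // => _; last rewrite disjoint_sym.
      exact: rims_disjoint.
    exact: rims_disjoint.
  case=> S [covS sub].
  have [T [lab]] : exists (T : eqType) (lab : pvertex 14 -> T),
      transition_labelling (perm_of_code 14 c) lab.
    by apply: (cover_labelling covS); apply: sub; rewrite !inE eqxx ?orbT.
  by apply: unlabellableP (allP codes_unlabellable c c_in).
Qed.

Theorem mainTheorem3 :
  (~ forall (G : sgraph) (D : {set subgraph G}),
       cyclically_edge_connected 5 G -> cubic G ->
       disjoint_cycles D ->
       ~ isomorphic G petersen ->
       exists S : seq (subgraph G), cycle_double_cover S /\ {subset D <= S})
  /\
  (exists G : 'I_12 -> sgraph,
     [/\ forall i, #|G i| = 34,
         forall i, counterexample (G i) &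
         forall i j, i != j -> ~ isomorphic (G i) (G j)]).
Proof.
pose G (i : 'I_12) := code_graph (nth [::] codes i).
have code_in (i : 'I_12) : nth [::] codes i \in codes by apply: mem_nth.
have counterG i : counterexample (G i) by apply: code_graph_counterexample.
split=> [cdc|].
  have [conn cub noniso [D [disjD noS]]] := counterG ord0.
  exact/noS/cdc.
exists G; split=> // [i|i j neq_ij iso_ij].
  exact: card_pgraph.
have := isomorphic_walk_pairing 4 5 iso_ij.
rewrite !walk_pairing_codeE ?(allP codes_valid) // => eq_walks.
have lt_size (k : 'I_12) : val k < size codes by apply: ltn_ord.
case/eqP: neq_ij; apply: val_inj; apply/eqP.
rewrite -(nth_uniq 0 _ _ codes_pairing_uniq) ?size_map ?lt_size //.
by rewrite !(nth_map [::]) ?eq_walks ?lt_size.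
Qed.
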